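(* Let $d\in\mathbb{N}$ and let $K\subseteq[0,1]^d$ be non-empty and convex. Then, for any $\rho\in[0,1]$, $$\mathrm{Vol}\big(\{\boldsymbol{x}\in\mathbb{R}^d : \mathrm{dist}(\boldsymbol{x},\partial K)\le\rho\}\big)\le d\,2^{d+4}\rho.$$
   Context: $\mathrm{Vol}$ denotes $d$-dimensional volume (Lebesgue measure), $\partial K$ is the topological boundary of $K$ in $\mathbb{R}^d$, and $\mathrm{dist}(\boldsymbol{x},A):=\inf_{\boldsymbol{y}\in A}\|\boldsymbol{x}-\boldsymbol{y}\|_2$ for $\boldsymbol{x}\in\mathbb{R}^d$ and $A\subseteq\mathbb{R}^d$, with $\|\cdot\|_2$ the Euclidean norm. *)

(* Defs.v *)
From mathcomp Require Import all_boot all_order all_algebra.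
From mathcomp Require Import all_classical all_reals all_analysis.

Set Implicit Arguments.
Unset Strict Implicit.
Unset Printing Implicit Defensive.

Import Order.TTheory GRing.Theory Num.Theory.
Import numFieldNormedType.Exports.

Local Open Scope classical_set_scope.
Local Open Scope ring_scope.

Definition norm2 (R : realType) (d : nat) (x : 'rV[R]_d) : R :=
  Num.sqrt (\sum_(i < d) x ord0 i ^+ 2).

(* Extended-real valued, so that the distance to the empty set is [+oo]. *)
Definition dist2 (R : realType) (d : nat) (x : 'rV[R]_d) (A : set 'rV[R]_d) :
    \bar R :=
  ereal_inf [set (norm2 (x - y))%:E | y in A].

(* The topology on ['rV[R]_d] is the one induced by the library's max norm,
   which is also the Euclidean one. *)
Definition boundary (T : topologicalType) (A : set T) : set T :=
  closure A `\` interior A.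

Definition ocbox (R : realType) (d : nat) (a b : 'rV[R]_d) : set 'rV[R]_d :=
  [set x | forall i : 'I_d, a ord0 i < x ord0 i <= b ord0 i].

Definition ocbox_vol (R : realType) (d : nat) (a b : 'rV[R]_d) : R :=
  \prod_(i < d) (b ord0 i - a ord0 i).

(* Lebesgue (outer) measure on R^d: the analogue of [mu_ext] for half-open
   boxes. As with the library's [lebesgue_measure] on R, it is a total function
   on sets, countably additive on the Lebesgue measurable ones. This is adequate
   only for [0 < d]: a box in R^0 is never empty. *)
Definition lebesgue_measure_rV (R : realType) (d : nat) (A : set 'rV[R]_d) :
    \bar R :=
  ereal_inf [set v : \bar R | exists a b : nat -> 'rV[R]_d,
    [/\ forall k (i : 'I_d), a k ord0 i <= b k ord0 i,
        A `<=` \bigcup_k ocbox (a k) (b k) &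
        v = (\sum_(0 <= k <oo) (ocbox_vol (a k) (b k))%:E)%E]].

(* Main.v *)
Require Import Defs.
From mathcomp Require Import all_boot all_order all_algebra.
From mathcomp Require Import all_classical all_reals all_analysis.
From mathcomp Require Import zify lra ring.

(** The region within [rho] of the boundary of [K] is covered by cells of a
    cubical grid of side [h = 1/m], and the cells are counted. Two different
    counts are needed, according to the size of [rho].

    For [rho < 1/2] only the sup norm is used. A cell meeting the region has its
    corner [c] at sup-distance less than [r = n h] from the boundary, for some
    [r] slightly larger than [rho]. Such a [c] lies in [C], the open
    [r]-neighbourhood of [K], but some corner [c +- 2r ... +- 2r] of the cube of
    radius [2r] about [c] lies outside [C]: otherwise [K] would meet all closed
    orthants at every point of the cube of radius [r] about [c], so that this
    cube would be contained in [K] by convexity ([convex_meets_orthants]), and no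
    boundary point of [K] could be that close to [c] ([boundary_exit]). Moving
    from [c] to that corner one coordinate at a time, let [M_j] be the set of
    points whose [2^j] translates by the corners of a cube of radius [2r] in the
    first [j] directions all lie in [C]. There is a direction [j] with [c] in
    [M_j] and [c + 2r e_j] or [c - 2r e_j] outside [M_j]. Since [M_j] is convex,
    on each grid line of direction [j] there are at most [2n] grid points of each
    of these two kinds ([convex_grid_line], [card_short_fibers]). With
    [N = 2n + m] grid points in each direction this makes at most
    [4 d n N^(d-1)] cells, of total volume [4 d r (1 + 2r)^(d-1)], which is at
    most [d 2^(d+1) r] as long as [r <= 1/2]; then [r] tends to [rho].

    For [rho >= 1/2] it suffices to show that the Euclidean [1]-neighbourhood of
    the unit cube has volume at most [8 d 2^d]. The sup norm would only give
    [3^d], so the Euclidean norm matters here: the sum of the squared distances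
    of the coordinates to [[0, 1]] is at most [1]. Weighting a point by
    [exp (- lambda s)], where [s] is that sum, turns the volume into a product of
    one-dimensional integrals and bounds it by
    [exp lambda * (1 + sqrt (pi / lambda))^d]; for [lambda = pi] this is a
    constant times [2^d]. On a grid of side [1/8], with the slightly larger
    [lambda] given by [exp (- lambda / 64) = 15/16], the bound [64 * 2^d] comes
    out, which suffices for [d >= 8] ([card_le_weight],
    [gaussian_weight_sum]). In smaller dimensions counting all cells is
    enough. *)

Set Implicit Arguments.
Unset Strict Implicit.
Unset Printing Implicit Defensive.

Import Order.TTheory GRing.Theory Num.Theory.
Import numFieldNormedType.Exports.

Local Open Scope classical_set_scope.
Local Open Scope ring_scope.

(** * Covers by finitely many boxes and by grid cells *)

Lemma lebesgue_measure_rV_le_boxes (R : realType) (d : nat) (d_gt0 : (0 < d)%N)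
    (s : seq ('rV[R]_d * 'rV[R]_d)) (S : set 'rV[R]_d) :
  (forall p, p \in s -> forall i, p.1 ord0 i <= p.2 ord0 i) ->
  (forall x, S x -> exists2 p, p \in s & ocbox p.1 p.2 x) ->
  (lebesgue_measure_rV S <= (\sum_(p <- s) ocbox_vol p.1 p.2)%:E)%E.
Proof.
(* Beyond the list the boxes are degenerate, and have volume 0 as [0 < d]. *)
move=> sle Ss; pose box j := nth (0, 0) s j.
have box_le j i : (box j).1 ord0 i <= (box j).2 ord0 i.
  have [js|js] := ltnP j (size s); first exact/sle/mem_nth.
  by rewrite /box nth_default.
have vol_ge0 j : 0 <= ocbox_vol (box j).1 (box j).2.
  by apply: prodr_ge0 => i _; rewrite subr_ge0.
apply: ereal_inf_lbound; exists (fun j => (box j).1), (fun j => (box j).2).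
split=> //.
  move=> x /Ss[p ps px]; exists (index p s) => //.
  by rewrite /box nth_index.
rewrite (nneseries_split 0 (size s)); last by move=> *; rewrite lee_fin.
rewrite eseries0 ?adde0 ?add0n; last first.
  move=> j sj _; rewrite /box nth_default //= /ocbox_vol.
  by rewrite (bigD1 (Ordinal d_gt0)) //= subrr mul0r.
by rewrite sumEFin (big_nth (0, 0)).
Qed.

(** The cell attached to [k] has [grid_point a h k] as its excluded lower
    corner, in accordance with boxes being open below. *)
Definition grid_point (R : realType) (N d : nat) (a h : R)
    (k : {ffun 'I_d -> 'I_N}) : 'rV[R]_d := \row_i (a + h * (k i)%:R).

Lemma lebesgue_measure_rV_le_cells (R : realType) (N d : nat) (a h : R)
    (T : {set {ffun 'I_d -> 'I_N}}) (S : set 'rV[R]_d) :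
  (0 < d)%N -> 0 <= h ->
  (forall x, S x -> exists2 k, k \in T &
     ocbox (grid_point a h k) (grid_point a h k + const_mx h) x) ->
  (lebesgue_measure_rV S <= (#|T|%:R * h ^+ d)%:E)%E.
Proof.
move=> d_gt0 h_ge0 ST.
pose cell (k : {ffun 'I_d -> 'I_N}) : 'rV[R]_d * 'rV[R]_d :=
  (grid_point a h k, grid_point a h k + const_mx h).
have -> : #|T|%:R * h ^+ d =
    \sum_(p <- [seq cell k | k <- enum T]) ocbox_vol p.1 p.2.
  rewrite big_map big_enum /= (eq_bigr (fun=> h ^+ d)); last first.
    move=> k _; rewrite /ocbox_vol -[in RHS](card_ord d) -prodr_const.
    by apply: eq_bigr => i _; rewrite !mxE; ring.
  by rewrite sumr_const mulr_natl.
apply: lebesgue_measure_rV_le_boxes => //.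
  by move=> p /mapP[k _ ->] i; rewrite !mxE lerDl.
move=> x /ST[k kT xk]; exists (cell k) => //.
by apply: map_f; rewrite mem_enum.
Qed.

(** The index of the cell in each direction is the least [j] such that the upper
    end [a + h (j + 1)] reaches the coordinate: half-open cells make the strict
    lower bound automatic. *)
Lemma grid_cell_exists (R : realType) (N d : nat) (a h : R) (x : 'rV[R]_d) :
  0 < h -> (forall i, a < x ord0 i <= a + h * N%:R) ->
  exists k : {ffun 'I_d -> 'I_N},
    ocbox (grid_point a h k) (grid_point a h k + const_mx h) x.
Proof.
move=> h_gt0 xN.
have cell1 i : exists j : 'I_N, a + h * j%:R < x ord0 i <= a + h * j%:R + h.
  have /andP[ax xa] := xN i.
  have ex : exists j, x ord0 i <= a + h * j%:R by exists N.
  case: (ex_minnP ex) => -[|j] xj jmin; first by move: xj; lra.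
  have jN : (j < N)%N by exact: jmin.
  exists (Ordinal jN) => /=; apply/andP; split.
    by rewrite ltNge; apply/negP => /jmin; rewrite ltnn.
  by move: xj; rewrite -natr1; lra.
have [k Hk] := choice cell1.
by exists [ffun i => k i] => i; rewrite !mxE !ffunE.
Qed.

(** * Counting grid points *)

(** The points of [Q] on a line of direction [j] have distinct [j]-th
    coordinates modulo [p]. Recording that residue frees the [j]-th coordinate,
    which can then store an arbitrary [t]: this injects [Q * 'I_N] into
    ['I_p * 'I_N^d]. The factor [N] on the left spares an exponent [d - 1]. *)
Lemma card_short_fibers (N d p : nat) (j : 'I_d)
    (Q : {set {ffun 'I_d -> 'I_N}}) :
  (forall k k', k \in Q -> k' \in Q -> (forall i, i != j -> k i = k' i) ->
     (k' j < k j + p)%N) ->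
  (#|Q| * N <= p * N ^ d)%N.
Proof.
move=> short; have [->|[k0 k0Q]] := set_0Vmem Q; first by rewrite cards0.
have p_gt0 : (0 < p)%N.
  have := short k0 k0 k0Q k0Q (fun _ _ => erefl).
  by case: (p) => //; rewrite addn0 ltnn.
pose code (u : {ffun 'I_d -> 'I_N} * 'I_N) : 'I_p * {ffun 'I_d -> 'I_N} :=
  (Ordinal (ltn_pmod (u.1 j) p_gt0), [ffun i => if i == j then u.2 else u.1 i]).
have code_inj : {in finset.setX Q [set: 'I_N]%SET &, injective code}.
  move=> [k t] [k' t'] /finset.setXP[/= kQ _] /finset.setXP[/= k'Q _].
  move=> [kk' /ffunP codeE].
  have tt' : t = t' by have := codeE j; rewrite !ffunE eqxx.
  have offj i : i != j -> k i = k' i.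
    by move=> ij; have := codeE i; rewrite !ffunE (negbTE ij).
  have kj : k j = k' j.
    apply: val_inj => /=.
    have := short _ _ kQ k'Q offj.
    have := short _ _ k'Q kQ (fun i ij => esym (offj i ij)).
    rewrite (divn_eq (k j) p) (divn_eq (k' j) p) kk' => lt1 lt2.
    have : ((k j %/ p) * p < (k' j %/ p).+1 * p)%N by lia.
    have : ((k' j %/ p) * p < (k j %/ p).+1 * p)%N by lia.
    by rewrite !ltn_pmul2r // => *; congr (_ * _ + _)%N; lia.
  by rewrite tt'; congr (_, _); apply/ffunP => i; have [->|/offj] := eqVneq i j.
have := max_card [in [set code u | u in finset.setX Q [set: 'I_N]%SET]%SET].
rewrite card_in_imset // cardsX cardsT card_ord card_prod card_ord.
by rewrite card_ffun !card_ord.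
Qed.

(** Exponential Chebyshev bound: each point of [T] contributes at least [q ^+ s]
    to the sum of the weights [\prod_i q ^+ f (k i)], and that sum over the whole
    grid factors over the coordinates. *)
Lemma card_le_weight (R : numFieldType) (N d s : nat) (f : 'I_N -> nat) (q : R)
    (T : {set {ffun 'I_d -> 'I_N}}) :
  0 <= q <= 1 -> (forall k, k \in T -> (\sum_i f (k i) <= s)%N) ->
  #|T|%:R * q ^+ s <= (\sum_j q ^+ f j) ^+ d.
Proof.
move=> /andP[q_ge0 q_le1] fs.
rewrite -[X in _ <= _ ^+ X]card_ord -prodr_const bigA_distr_bigA /=.
rewrite mulr_natl -sumr_const [leRHS](bigID [in T]) /= -[leLHS]addr0.
rewrite lerD //; last first.
  by apply: sumr_ge0 => k _; apply: prodr_ge0 => i _; apply: exprn_ge0.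
apply: ler_sum => k kT; rewrite -expr_sum.
by rewrite ler_wiXn2l // fs.
Qed.

(** * Convex sets and orthants *)

Lemma convex_combE (R : realType) (d : nat) (K : set 'rV[R]_d) (x y : 'rV[R]_d)
    (t : R) :
  convex_set K -> K x -> K y -> 0 <= t <= 1 -> K (t *: x + (1 - t) *: y).
Proof.
move=> Kc Kx Ky /andP[t0 t1].
have := Kc x y (Itv01 t0 t1) (mem_set Kx) (mem_set Ky).
by rewrite inE.
Qed.

(** One coordinate at a time: two points of [K] lying on opposite sides of [z]
    in direction [j], but on the same side in the later directions, have a convex
    combination that agrees with [z] in direction [j] and stays on those sides
    later. This replaces the separation theorem. *)
Lemma convex_meets_orthants (R : realType) (d : nat) (K : set 'rV[R]_d)
    (z : 'rV[R]_d) :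
  convex_set K ->
  (forall e : 'I_d -> bool, exists2 y, K y & forall i,
     if e i then z ord0 i <= y ord0 i else y ord0 i <= z ord0 i) ->
  K z.
Proof.
move=> Kc orth.
(* After [j] steps the first [j] coordinates already agree with [z]. *)
suff /(_ d (fun=> true))[y Ky yz] : forall (j : nat) (e : 'I_d -> bool),
    exists2 y, K y & forall i : 'I_d,
      if (i < j)%N then y ord0 i = z ord0 i else
      if e i then z ord0 i <= y ord0 i else y ord0 i <= z ord0 i.
  suff -> : z = y by [].
  by apply/rowP => i; have := yz i; rewrite ltn_ord => ->.
elim=> [|j IHj] e; first by have [y Ky yz] := orth e; exists y.
have [dj|jd] := leqP d j.
  have [y Ky yz] := IHj e; exists y => // i; have := yz i.
  by rewrite ltnS (leq_trans (ltn_ord i) dj) (ltnW (leq_trans (ltn_ord i) dj)).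
pose j0 := Ordinal jd; pose upd b i := if i == j0 then b else e i.
have [p Kp pz] := IHj (upd true); have [q Kq qz] := IHj (upd false).
have := pz j0; have := qz j0; rewrite /upd eqxx ltnn => qj pj.
have [t t01 tz] : exists2 t, 0 <= t <= 1 &
    t * p ord0 j0 + (1 - t) * q ord0 j0 = z ord0 j0.
  have [pq|pq] := eqVneq (p ord0 j0) (q ord0 j0).
    by exists 0; [lra|move: pj qj; rewrite pq; lra].
  have lt_qp : 0 < p ord0 j0 - q ord0 j0.
    by rewrite subr_gt0 lt_neqAle eq_sym pq (le_trans qj).
  exists ((z ord0 j0 - q ord0 j0) / (p ord0 j0 - q ord0 j0)).
    by rewrite divr_ge0 ?(ltW lt_qp) ?subr_ge0 //= ler_pdivrMr // mul1r; lra.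
  by field; rewrite gt_eqF.
exists (t *: p + (1 - t) *: q); first exact: convex_combE.
move=> i; have := pz i; have := qz i.
rewrite !mxE ltnS [(i <= j)%N]leq_eqVlt /upd.
have [->|ij] := eqVneq i j0; first by rewrite eqxx.
have -> : (i == j :> nat) = false.
  by apply: contraNF ij => /eqP ij; exact/eqP/val_inj.
move: t01 => /andP[t0 t1].
case: (i < j)%N => /= [-> ->|]; first by ring.
by case: (e i); nra.
Qed.

(** * Erosion of a neighbourhood, one direction at a time *)

Definition cube_nbhd (R : realType) (d : nat) (K : set 'rV[R]_d) (r : R) :
    set 'rV[R]_d :=
  [set c | exists2 y, K y & forall i, `|c ord0 i - y ord0 i| < r].

(** The signed corner, given by the sign vector [e], of the cube of radius [2 r]
    in the first [j] directions. *)
Definition corner (R : realType) (d : nat) (r : R) (j : nat)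
    (e : 'I_d -> bool) : 'rV[R]_d :=
  \row_i (if (i < j)%N then (if e i then 2 * r else - (2 * r)) else 0).

(** For convex [K] this is the erosion of [cube_nbhd K r] by the cube of radius
    [2 r] in the first [j] directions, since a convex set contains a cube as soon
    as it contains its corners. *)
Definition eroded (R : realType) (d : nat) (K : set 'rV[R]_d) (r : R) (j : nat) :
    set 'rV[R]_d :=
  [set c | forall e, cube_nbhd K r (c + corner r j e)].

Lemma eroded0 (R : realType) (d : nat) (K : set 'rV[R]_d) r c :
  cube_nbhd K r c -> eroded K r 0 c.
Proof.
move=> Kc e; suff -> : corner r 0 e = 0 by rewrite addr0.
by apply/rowP => i; rewrite !mxE.
Qed.

Lemma eroded_convex (R : realType) (d : nat) (K : set 'rV[R]_d) r j x y t :
  convex_set K -> eroded K r j x -> eroded K r j y -> 0 <= t <= 1 ->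
  eroded K r j (t *: x + (1 - t) *: y).
Proof.
move=> Kc Kx Ky t01 e; have [p Kp xp] := Kx e; have [q Kq yq] := Ky e.
exists (t *: p + (1 - t) *: q); first exact: convex_combE.
move=> i; have := xp i; have := yq i; rewrite !mxE !ltr_norml.
move: (if _ then _ else _) t01 => s /andP[t0 t1] /andP[? ?] /andP[? ?].
have [t_gt0|t_le0] := ltP 0 t; last first.
  have -> : t = 0 by apply/le_anti/andP.
  by apply/andP; lra.
by apply/andP; split; nra.
Qed.

(** Enlarging [K] by [r] and eroding it by [2 r] amounts to eroding it by [r]:
    the point of [K] within [r] of the corner [c + 2 r e] lies in the orthant of
    signs [e] at every point within [r] of [c]. *)
Lemma eroded_interior (R : realType) (d : nat) (K : set 'rV[R]_d) r c :
  convex_set K -> eroded K r d c ->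
  forall z : 'rV[R]_d, (forall i, `|c ord0 i - z ord0 i| < r) -> K z.
Proof.
move=> Kc Kd z cz; apply: convex_meets_orthants => // e.
have [y Ky yc] := Kd e; exists y => // i.
have := yc i; have := cz i; rewrite !mxE ltn_ord !ltr_norml.
by case: (e i); lra.
Qed.

(** The corner about [c] that fails in [j + 1] directions is also a corner in [j]
    directions about the point moved by [2 r] along direction [j], with the sign
    that this corner has there. *)
Lemma eroded_step (R : realType) (d : nat) (K : set 'rV[R]_d) r (j : 'I_d) c :
  eroded K r j c -> ~ eroded K r j.+1 c ->
  ~ eroded K r j (c + (2 * r) *: delta_mx ord0 j) \/
  ~ eroded K r j (c - (2 * r) *: delta_mx ord0 j).
Proof.
move=> cj /existsNP[e ce].
have cornerS : corner r j.+1 e =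
    (if e j then 1 else -1) *: ((2 * r) *: delta_mx ord0 j) + corner r j e.
  apply/rowP => i; rewrite !mxE eqxx /= ltnS leq_eqVlt.
  have [->|ij] := eqVneq i j; first by rewrite eqxx ltnn /=; case: (e j); ring.
  by rewrite (inj_eq val_inj) (negbTE ij) /= !mulr0 add0r.
move: ce; rewrite cornerS addrA; case: (e j) => ce; [left|right] => /(_ e).
  by move: ce; rewrite scale1r.
by move: ce; rewrite scaleN1r.
Qed.

(** * Grid points near the boundary *)

Lemma nbhs_cube (R : realType) (d : nat) (c y : 'rV[R]_d) (r : R) :
  0 < r -> (forall i, `|c ord0 i - y ord0 i| < r) ->
  nbhs y [set z : 'rV[R]_d | forall i, `|c ord0 i - z ord0 i| < r].
Proof.
move=> r_gt0 cy.
have -> : [set z : 'rV[R]_d | forall i, `|c ord0 i - z ord0 i| < r] = ball c r.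
  apply/seteqP; split=> z /= cz.
    by split=> // i j; rewrite ord1; exact: cz.
  by move=> i; have [_ /(_ ord0 i)] := cz.
apply: open_nbhs_nbhs; split; first exact: ball_open.
by split=> // i j; rewrite ord1; exact: cy.
Qed.

Lemma boundary_cube_nbhd (R : realType) (d : nat) (K : set 'rV[R]_d) r
    (c y : 'rV[R]_d) :
  0 < r -> boundary K y -> (forall i, `|c ord0 i - y ord0 i| < r) ->
  cube_nbhd K r c.
Proof.
move=> r_gt0 [clKy _] cy.
by have [z [Kz cz]] := clKy _ (nbhs_cube r_gt0 cy); exists z.
Qed.

(** The point starts in [eroded K r 0], since it is close to the closure of [K],
    and cannot stay until [eroded K r d], since it is close to a point outside the
    interior of [K]. *)
Lemma boundary_exit (R : realType) (d : nat) (K : set 'rV[R]_d) r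
    (c y : 'rV[R]_d) :
  convex_set K -> 0 < r -> boundary K y ->
  (forall i, `|c ord0 i - y ord0 i| < r) ->
  exists2 j : 'I_d, eroded K r j c & ~ eroded K r j.+1 c.
Proof.
move=> Kc r_gt0 Ky cy; apply: contrapT => stay.
have erodedc j : (j <= d)%N -> eroded K r j c.
  elim: j => [_|j IHj jd]; first exact/eroded0/(boundary_cube_nbhd r_gt0 Ky).
  apply: contrapT => cj; apply: stay.
  by exists (Ordinal jd); [exact/IHj/ltnW|].
case: Ky => _; apply; apply: filterS (nbhs_cube r_gt0 cy) => z.
by move=> cz; apply: (eroded_interior Kc (erodedc d (leqnn d))) => i; exact: cz.
Qed.

(** Both shifted points lie on the segment joining the two grid points. Hence on
    one line the points of [B] that leave [B] after [p] steps in a given sense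
    span fewer than [p] steps. *)
Lemma convex_grid_line (R : realType) (N d p : nat) (a h : R)
    (B : set 'rV[R]_d) (j : 'I_d) (k k' : {ffun 'I_d -> 'I_N}) :
  (forall x y t, B x -> B y -> 0 <= t <= 1 -> B (t *: x + (1 - t) *: y)) ->
  B (grid_point a h k) -> B (grid_point a h k') ->
  (forall i, i != j -> k i = k' i) -> (k j + p <= k' j)%N ->
  B (grid_point a h k + (h * p%:R) *: delta_mx ord0 j) /\
  B (grid_point a h k' - (h * p%:R) *: delta_mx ord0 j).
Proof.
move=> Bc Bk Bk' offj kk'.
have [p0|p_gt0] := posnP p.
  by rewrite p0 mulr0 scale0r addr0 subr0.
pose D : R := (k' j)%:R - (k j)%:R.
have pD : p%:R <= D by rewrite /D lerBrDl -natrD ler_nat.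
have p_gt0' : 0 < p%:R :> R by rewrite ltr0n.
have D_gt0 : 0 < D := lt_le_trans p_gt0' pD.
have pD01 : 0 <= p%:R / D <= 1.
  by rewrite divr_ge0 ?(ltW p_gt0') ?(ltW D_gt0) //= ler_pdivrMr // mul1r.
split.
  suff -> : grid_point a h k + (h * p%:R) *: delta_mx ord0 j =
      (p%:R / D) *: grid_point a h k' + (1 - p%:R / D) *: grid_point a h k.
    exact: Bc.
  apply/rowP => i; rewrite !mxE eqxx /=.
  have [->|/offj ->] := eqVneq i j; last by rewrite mulr0n; ring.
  have -> : ((k' j)%:R : R) = D + (k j)%:R by rewrite /D subrK.
  by rewrite mulr1n; field; rewrite gt_eqF.
suff -> : grid_point a h k' - (h * p%:R) *: delta_mx ord0 j =
    (p%:R / D) *: grid_point a h k + (1 - p%:R / D) *: grid_point a h k'.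
  exact: Bc.
apply/rowP => i; rewrite !mxE eqxx /=.
have [->|/offj ->] := eqVneq i j; last by rewrite mulr0n; ring.
have -> : ((k' j)%:R : R) = D + (k j)%:R by rewrite /D subrK.
by rewrite mulr1n; field; rewrite gt_eqF.
Qed.

(** There are [d] directions and two senses in which to leave an eroded set by a
    step of length [2 r], that is, of [2 * n] grid units; each of these
    [d * 2] families has at most [2 * n] points per line. *)
Lemma card_near_boundary (R : realType) (N d n : nat) (a h : R)
    (K : set 'rV[R]_d) (T : {set {ffun 'I_d -> 'I_N}}) :
  convex_set K -> 0 < h -> (0 < n)%N ->
  (forall k, k \in T -> exists2 y, boundary K y &
     forall i, `|grid_point a h k ord0 i - y ord0 i| < h * n%:R) ->
  (#|T| * N <= d * (4 * n) * N ^ d)%N.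
Proof.
move=> Kc h_gt0 n_gt0 Tbd; set r := h * n%:R in Tbd.
have r_gt0 : 0 < r by rewrite mulr_gt0 // ltr0n.
have r2 : 2 * r = h * (2 * n)%:R by rewrite /r natrM; ring.
pose exit_up (j : 'I_d) := [set k : {ffun 'I_d -> 'I_N} |
  `[< eroded K r j (grid_point a h k) /\
      ~ eroded K r j (grid_point a h k + (2 * r) *: delta_mx ord0 j) >]]%SET.
pose exit_down (j : 'I_d) := [set k : {ffun 'I_d -> 'I_N} |
  `[< eroded K r j (grid_point a h k) /\
      ~ eroded K r j (grid_point a h k - (2 * r) *: delta_mx ord0 j) >]]%SET.
have exit_line (j : 'I_d) (k k' : {ffun 'I_d -> 'I_N}) :
    eroded K r j (grid_point a h k) ->
    eroded K r j (grid_point a h k') -> (forall i, i != j -> k i = k' i) ->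
    (k j + 2 * n <= k' j)%N ->
    eroded K r j (grid_point a h k + (2 * r) *: delta_mx ord0 j) /\
    eroded K r j (grid_point a h k' - (2 * r) *: delta_mx ord0 j).
  by rewrite r2; apply: convex_grid_line => *; exact: eroded_convex.
have card_up j : (#|exit_up j| * N <= 2 * n * N ^ d)%N.
  apply: (@card_short_fibers N d _ j) => k k'.
  rewrite !inE => -[kj kout] [k'j _] offj.
  by case: ltnP => // /(exit_line _ _ _ kj k'j offj)[/kout].
have card_down j : (#|exit_down j| * N <= 2 * n * N ^ d)%N.
  apply: (@card_short_fibers N d _ j) => k k'.
  rewrite !inE => -[kj _] [k'j k'out] offj.
  by case: ltnP => // /(exit_line _ _ _ kj k'j offj)[_ /k'out].
have Texit : T \subset (\bigcup_j (exit_up j :|: exit_down j))%SET.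
  apply/fintype.subsetP => k /Tbd[y Ky yk].
  have [j kj kjS] := boundary_exit Kc r_gt0 Ky yk.
  apply/finset.bigcupP; exists j => //; rewrite !inE; apply/orP.
  by case: (eroded_step kj kjS) => ?; [left|right]; exact/asboolP.
apply: leq_trans
  (_ : (\sum_(j < d) (#|exit_up j| + #|exit_down j|)) * N <= _)%N.
  rewrite leq_mul2r (leq_trans (subset_leq_card Texit)) ?orbT //=.
  apply: (big_ind2 (fun (A : {set _}) (m : nat) => #|A| <= m)%N) => //.
  - by rewrite cards0.
  - move=> A m B l Am Bl; apply: leq_trans (leq_add Am Bl).
    exact: leq_card_setU.
  - by move=> j _; exact: leq_card_setU.
rewrite big_distrl /= -mulnA -[X in (_ <= X * _)%N]card_ord -sum_nat_const.
apply: leq_sum => j _; rewrite mulnDl.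
by have -> : (4 * n = 2 * n + 2 * n)%N; [lia | rewrite mulnDl leq_add].
Qed.

(** * Volume bound for small distances *)

Lemma le_norm2 (R : realType) (d : nat) (x : 'rV[R]_d) (i : 'I_d) :
  `|x ord0 i| <= norm2 x.
Proof.
rewrite -sqrtr_sqr; apply: ler_wsqrtr; rewrite (bigD1 i) //= lerDl.
by apply: sumr_ge0 => *; rewrite sqr_ge0.
Qed.

Lemma dist2_witness (R : realType) (d : nat) (A : set 'rV[R]_d) (x : 'rV[R]_d)
    (rho rho' : R) :
  (dist2 x A <= rho%:E)%E -> rho < rho' ->
  exists2 y, A y & norm2 (x - y) < rho'.
Proof.
move=> xA rr'.
have : (dist2 x A < rho'%:E)%E by apply: le_lt_trans xA _; rewrite lte_fin.
by move=> /ereal_inf_lt[_ [y Ay <-]]; rewrite lte_fin; exists y.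
Qed.

Lemma boundary_unit_cube (R : realType) (d : nat) (K : set 'rV[R]_d)
    (y : 'rV[R]_d) :
  (forall x : 'rV[R]_d, K x -> forall i : 'I_d, 0 <= x ord0 i <= 1) ->
  boundary K y -> forall i : 'I_d, 0 <= y ord0 i <= 1.
Proof.
move=> K01 [clKy _] i.
have Kclose e : 0 < e -> exists2 x, K x & `|y ord0 i - x ord0 i| < e.
  move=> e_gt0; have yy j : `|y ord0 j - y ord0 j| < e by rewrite subrr normr0.
  by have [x [Kx yx]] := clKy _ (nbhs_cube e_gt0 yy); exists x.
apply/andP; split; rewrite leNgt; apply/negP => yi.
  have [|x /K01/(_ i) x01] := Kclose (- y ord0 i); first by lra.
  by rewrite ltr_norml; lra.
have [|x /K01/(_ i) x01] := Kclose (y ord0 i - 1); first by lra.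
by rewrite ltr_norml; lra.
Qed.

(** The hypothesis on [rho] leaves room for one cell: a point at distance at most
    [rho] from the boundary lies in a cell whose lower corner is at distance less
    than [n / m]. *)
Lemma near_boundary_le_grid (R : realType) (d n m : nat) (K : set 'rV[R]_d)
    (rho : R) :
  (0 < d)%N ->
  (forall x : 'rV[R]_d, K x -> forall i : 'I_d, 0 <= x ord0 i <= 1) ->
  convex_set K -> (0 < n)%N -> (2 * n <= m)%N -> rho < (n%:R - 1) / m%:R ->
  (lebesgue_measure_rV [set x : 'rV[R]_d | dist2 x (boundary K) <= rho%:E]
     <= (d%:R * 2 ^+ d.+1 * (n%:R / m%:R))%:E)%E.
Proof.
move=> d_gt0 K01 Kc n_gt0 nm rho_lt; pose N := (2 * n + m)%N.
have m_gt0 : (0 < m)%N by lia.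
have m_neq0 : m%:R != 0 :> R by rewrite pnatr_eq0 -lt0n.
pose h : R := m%:R^-1.
have h_gt0 : 0 < h by rewrite invr_gt0 ltr0n.
have hm : h * m%:R = 1 by rewrite mulVf.
pose a : R := - (h * n%:R).
pose T := [set k : {ffun 'I_d -> 'I_N} | `[< exists2 y, boundary K y &
  forall i, `|grid_point a h k ord0 i - y ord0 i| < h * n%:R >]]%SET.
have cardT : (#|T| * N <= d * (4 * n) * N ^ d)%N.
  apply: (@card_near_boundary R _ _ n a h K) => // k.
  by rewrite inE => /asboolW.
have muS := @lebesgue_measure_rV_le_cells R N d a h T _ d_gt0 (ltW h_gt0).
apply: le_trans (muS _ _) _.
  move=> x /= /dist2_witness/(_ rho_lt)[y Ky xy].
  have xyi i : `|x ord0 i - y ord0 i| < h * n%:R - h.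
    have := le_lt_trans (le_norm2 (x - y) i) xy; rewrite !mxE.
    by rewrite mulrBl mul1r -/h [_ / _]mulrC.
  have y01 := boundary_unit_cube K01 Ky.
  have [i|k xk] := @grid_cell_exists R N d a h x h_gt0.
    have := xyi i; have := y01 i; rewrite ltr_norml /a /N natrD natrM mulrDr hm.
    by lra.
  exists k => //; rewrite inE; apply/asboolP; exists y => // i.
  by have := xyi i; have := xk i; rewrite !ltr_norml !mxE; lra.
rewrite lee_fin.
have {}cardT : (#|T| <= d * (4 * n) * (2 * m) ^ d.-1)%N.
  have N_gt0 : (0 < N)%N by rewrite /N; lia.
  rewrite -(leq_pmul2r N_gt0) (leq_trans cardT) //.
  have -> : (N ^ d = N ^ d.-1 * N)%N by rewrite -expnSr prednK.
  rewrite mulnA !leq_mul //; case: d.-1 => // p; rewrite leq_exp2r // /N; lia.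
apply: (@le_trans _ _ ((d * (4 * n) * (2 * m) ^ d.-1)%:R * h ^+ d)).
  by rewrite ler_pM2r ?exprn_gt0 // ler_nat.
case: d d_gt0 {K K01 Kc T muS cardT} => // d _.
rewrite /h !natrM natrX natrM exprMn !exprS exprVn /=.
have md_neq0 : m%:R ^+ d != 0 :> R by rewrite expf_neq0.
by rewrite le_eqVlt; apply/orP; left; apply/eqP; field; rewrite md_neq0 m_neq0.
Qed.

(** The grid bound holds with [rho] replaced by rationals [n / m] that approach
    it from above, so it holds for [rho] itself; this includes [rho = 0]. *)
Lemma near_boundary_le_small (R : realType) (d : nat) (K : set 'rV[R]_d)
    (rho : R) :
  (0 < d)%N ->
  (forall x : 'rV[R]_d, K x -> forall i : 'I_d, 0 <= x ord0 i <= 1) ->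
  convex_set K -> 0 <= rho < 2^-1 ->
  (lebesgue_measure_rV [set x : 'rV[R]_d | dist2 x (boundary K) <= rho%:E]
     <= (d%:R * 2 ^+ d.+1 * rho)%:E)%E.
Proof.
move=> d_gt0 K01 Kc /andP[rho_ge0 rho_lt]; apply/lee_addgt0Pr => e e_gt0.
pose C : R := d%:R * 2 ^+ d.+1.
have C_gt0 : 0 < C by rewrite mulr_gt0 ?ltr0n // exprn_gt0.
(* [g] bounds [n / m - rho]: it keeps [n / m <= 1/2] and the error below [e]. *)
pose g := Num.min (2^-1 - rho) (e / C).
have g_gt0 : 0 < g by rewrite lt_min divr_gt0 // subr_gt0 rho_lt.
(* These satisfy [rho + 1 / m < n / m <= rho + 2 / m < rho + g]. *)
pose m := (Num.trunc (2 / g)).+1; pose n := (Num.trunc (rho * m%:R)).+2.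
have m_gt : 2 / g < m%:R by apply: truncnS_gt.
have m_gt0 : 0 < m%:R :> R by rewrite ltr0n.
have gm : 2 < g * m%:R by move: m_gt; rewrite ltr_pdivrMr // mulrC.
have /andP[n_le n_gt] := truncn_itv (mulr_ge0 rho_ge0 (ltW m_gt0)).
have n_itv : n%:R - 2 <= rho * m%:R < n%:R - 1.
  by move: n_le n_gt; rewrite /n -!natr1; lra.
have g_le : g <= 2^-1 - rho by rewrite ge_min lexx.
have g_le' : g <= e / C by rewrite ge_min lexx orbT.
have nm : n%:R / m%:R <= rho + g by rewrite ler_pdivrMr //; lra.
apply: le_trans (@near_boundary_le_grid R d n m K rho _ _ _ _ _ _) _ => //.
- by rewrite -(ler_nat R) natrM; nra.
- by rewrite ltr_pdivlMr //; lra.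
- rewrite -EFinD lee_fin -/C.
  apply: le_trans (ler_wpM2l (ltW C_gt0) nm) _.
  rewrite mulrDr lerD2l; move: g_le'; rewrite ler_pdivlMr //; lra.
Qed.

(** * Volume bound for large distances *)

(** With 26 intervals of length [1/8] starting at [-9/8], interval [j] is at
    distance [(8 - j) + (j - 17)] eighths from [[0, 1]], where the truncated
    subtractions handle the two sides. The bound [16 = 8 * 2] means that the
    weighted length of [[-9/8, 17/8]] is at most [2], the base required of the
    volume bound; the ratio [15/16] is chosen so that moreover
    [(16/15)^64 <= 64]. *)
Lemma gaussian_weight_sum (R : realType) :
  \sum_(j < 26) (15 / 16 : R) ^+ ((8 - j + (j - 17)) ^ 2) <= 16.
Proof. by rewrite !big_ord_recr big_ord0 /=; lra. Qed.

Lemma near_unit_cube_excess (R : realType) (a b x y : R) (j : nat) :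
  a = - (9 / 8) + 8^-1 * j%:R -> b = a + 8^-1 -> a < x <= b -> 0 <= y <= 1 ->
  ((8 - j + (j - 17)) ^ 2)%:R <= 64 * (x - y) ^+ 2.
Proof.
move=> -> -> xab y01.
have [j8|j8] := leqP j 8.
  have -> : (8 - j + (j - 17) = 8 - j)%N by lia.
  rewrite natrX natrB //.
  have : j%:R <= 8 :> R by rewrite ler_nat.
  by move: j%:R xab => u; nra.
have [j17|j17] := leqP 17 j.
  have -> : (8 - j + (j - 17) = j - 17)%N by lia.
  rewrite natrX natrB //.
  have : 17 <= j%:R :> R by rewrite ler_nat.
  by move: j%:R xab => u; nra.
have -> : (8 - j + (j - 17) = 0)%N by lia.
by rewrite mulr_ge0 // sqr_ge0.
Qed.

(** Only the Euclidean [1]-neighbourhood of the unit cube matters here. The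
    squared distances of the grid intervals to [[0, 1]], in units of [1/64], are
    integers, so that a sum less than [65] is at most [64] and an approximate
    nearest point is enough. *)
Lemma near_boundary_le_large (R : realType) (d : nat) (K : set 'rV[R]_d)
    (rho : R) :
  (0 < d)%N ->
  (forall x : 'rV[R]_d, K x -> forall i : 'I_d, 0 <= x ord0 i <= 1) ->
  rho <= 1 ->
  (lebesgue_measure_rV [set x : 'rV[R]_d | dist2 x (boundary K) <= rho%:E]
     <= (d%:R * 2 ^+ (d + 3))%:E)%E.
Proof.
move=> d_gt0 K01 rho1.
pose a : R := - (9 / 8); pose h : R := 8^-1.
pose f (j : 'I_26) := ((8 - j + (j - 17)) ^ 2)%N.
pose T := [set k : {ffun 'I_d -> 'I_26} | (\sum_i f (k i) <= 64)%N]%SET.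
have h_ge0 : 0 <= h by rewrite invr_ge0.
have muS := @lebesgue_measure_rV_le_cells R 26 d a h T _ d_gt0 h_ge0.
apply: le_trans (muS _ _) _ => [x /=|].
  (* [64 * (1 + 1/200)^2 < 65], as the integrality argument requires. *)
  have rho_lt : rho < 1 + 200^-1 by lra.
  move=> /dist2_witness/(_ rho_lt)[y Ky xy].
  have y01 := boundary_unit_cube K01 Ky.
  have [|i|k xk] := @grid_cell_exists R 26 d a h x; first by rewrite /h; lra.
    have := le_lt_trans (le_norm2 (x - y) i) xy; have := y01 i.
    by rewrite !mxE ltr_norml /a /h; lra.
  exists k => //; rewrite inE -ltnS -(ltr_nat R).
  have fxy i : (f (k i))%:R <= 64 * (x - y) ord0 i ^+ 2.
    have := xk i; rewrite !mxE => xki.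
    exact: near_unit_cube_excess erefl erefl xki (y01 i).
  rewrite natr_sum; apply: le_lt_trans (ler_sum _ (fun i _ => fxy i)) _.
  rewrite -mulr_sumr.
  have sum_ge0 : 0 <= \sum_i (x - y) ord0 i ^+ 2.
    by apply: sumr_ge0 => i _; exact: sqr_ge0.
  rewrite -(sqr_sqrtr sum_ge0) -/(norm2 _).
  have := sqrtr_ge0 (\sum_i (x - y) ord0 i ^+ 2); rewrite -/(norm2 _).
  by move: (norm2 _) xy => u; nra.
rewrite lee_fin exprVn ler_pdivrMr ?exprn_gt0 //.
(* For [d < 8] all the [26 ^ d] cells may be counted; the weighted bound
   [64 * 16 ^ d] is good enough from [d = 8] on. *)
have [d_lt8|d_ge8] := ltnP d 8.
  apply: (@le_trans _ _ (26 ^+ d)).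
    rewrite -natrX ler_nat (leq_trans (max_card _)) //.
    by rewrite card_ffun !card_ord.
  clear -d_gt0 d_lt8; case: d d_gt0 d_lt8 => // d _.
  by do 7 (case: d => [|d]; first by move=> _; lra).
have q01 : 0 <= (15 / 16 : R) <= 1 by apply/andP; lra.
have Tf k : k \in T -> (\sum_i f (k i) <= 64)%N by rewrite inE.
have cardT := card_le_weight q01 Tf.
have q64 : 1 <= 64 * (15 / 16 : R) ^+ 64 by lra.
have card_le : #|T|%:R <= 64 * 16 ^+ d :> R.
  apply: le_trans (ler_peMr (ler0n _ _) q64) _.
  rewrite mulrCA ler_pM2l //; apply: le_trans cardT _.
  apply: lerXn2r (gaussian_weight_sum R); rewrite nnegrE //.
  by apply: sumr_ge0 => j _; rewrite exprn_ge0.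
apply: le_trans card_le _.
have -> : 16 = 2 * 8 :> R by ring.
rewrite exprMn exprD !mulrA ler_pM2r ?exprn_gt0 //.
have d8 : 8 <= d%:R :> R by rewrite ler_nat.
have : 0 < 2 ^+ d :> R by rewrite exprn_gt0.
by nra.
Qed.

(** * The volume of the neighbourhood of the boundary *)

Theorem corollary7 (R : realType) (d : nat) (d_gt0 : (0 < d)%N)
    (K : set 'rV[R]_d)
    (K01 : forall x : 'rV[R]_d, K x -> forall i : 'I_d, 0 <= x ord0 i <= 1)
    (K_nonempty : K !=set0) (K_convex : convex_set K)
    (rho : R) (rho01 : 0 <= rho <= 1) :
  (lebesgue_measure_rV [set x : 'rV[R]_d | dist2 x (boundary K) <= rho%:E]
     <= (d%:R * 2 ^+ (d + 4) * rho)%:E)%E.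
Proof.
have /andP[rho_ge0 rho_le1] := rho01.
have [rho_lt|rho_ge] := ltP rho 2^-1.
  have rho_itv : 0 <= rho < 2^-1 by rewrite rho_ge0.
  apply: le_trans (near_boundary_le_small d_gt0 K01 K_convex rho_itv) _.
  rewrite lee_fin ler_wpM2r // ler_wpM2l ?ler0n // ler_weXn2l //; first lra.
  by rewrite addnS ltnS leq_addr.
apply: le_trans (near_boundary_le_large d_gt0 K01 rho_le1) _.
rewrite lee_fin -mulrA ler_wpM2l ?ler0n // [(d + 4)%N]addnS exprS.
have : 0 < 2 ^+ (d + 3) :> R by rewrite exprn_gt0.
by nra.
Qed.
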